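(* Let $\mathcal{A}$ be a nonnegative $m$th order, $n$ dimensional tensor. Then $\mathcal{A}$ is s-primitive if and only if all of the following hold: (i) $\mathcal{A}$ is s-irreducible; (ii) $S_{\mathcal{A}}(i,j)\neq\emptyset$ whenever $i,j\in\langle n\rangle$ and $i\rightarrow j$ in $\mathcal{A}$; and (iii) all $i\in\langle n\rangle$ are aperiodic in $\mathcal{A}$.
   Context: Throughout, $m,n\ge 2$ are integers and $\langle n\rangle=\{1,2,\ldots,n\}$. An $m$th order, $n$ dimensional tensor $\mathcal{A}=[a_{i_1i_2\ldots i_m}]$ is an array of real numbers indexed by $i_1,\ldots,i_m\in\langle n\rangle$; inequalities such as $\mathcal{A}\ge0$ (nonnegative) and $\mathcal{A}>0$ are entrywise. Box product: for $m$th order, $n$ dimensional tensors $\mathcal{A}=[a_{i_1\ldots i_m}]$ and $\mathcal{B}=[b_{i_1\ldots i_m}]$, the tensor $\mathcal{C}=\mathcal{A}\boxtimes\mathcal{B}$ is the $m$th order, $n$ dimensional tensor with entries $$c_{i_1i_2\ldots i_m}=\sum_{j\in\langle n\rangle}a_{i_1ji_2\ldots i_{m-1}}\,b_{ji_2\ldots i_m},\quad i_1,\ldots,i_m\in\langle n\rangle$$ (for $m\ge3$ it is in general not associative). Powers: $\mathcal{A}^1=\mathcal{A}$ and $\mathcal{A}^\alpha=\mathcal{A}^{\alpha-1}\boxtimes\mathcal{A}$ for integers $\alpha\ge2$. Write $\mathcal{A}^\alpha=[a^{(\alpha)}_{i_1i_2\ldots i_m}]$. s-irreducible: a nonnegative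 tensor $\mathcal{A}$ is s-irreducible if for any $i_1,i_2,\ldots,i_m\in\langle n\rangle$ there exists an integer $\alpha\ge1$, which may depend on $i_1,\ldots,i_m$, such that $a^{(\alpha)}_{i_1i_2\ldots i_m}>0$. s-primitive: a nonnegative tensor $\mathcal{A}$ is s-primitive if there exists an integer $\alpha\ge1$ such that $\mathcal{A}^\alpha>0$. Accessibility: for $i,j\in\langle n\rangle$, $j$ is accessible from $i$ in $\mathcal{A}$, written $i\rightarrow j$, if for any $i_3,\ldots,i_m\in\langle n\rangle$ there exists an integer $\alpha\ge1$, which may depend on $i_3,\ldots,i_m$, such that $a^{(\alpha)}_{jii_3\ldots i_m}>0$. For $i,j\in\langle n\rangle$, $$S_{\mathcal{A}}(i,j)=\{\alpha\ge1 : a^{(\alpha)}_{jii_3\ldots i_m}>0 \text{ for all } i_3,\ldots,i_m\in\langle n\rangle\},\qquad S_{\mathcal{A}}(i)=S_{\mathcal{A}}(i,i).$$ Aperiodicity: $i\in\langle n\rangle$ is aperiodic in $\mathcal{A}$ if $\gcd(S_{\mathcal{A}}(i))=1$, where $\gcd$ is the greatest common divisor (and $\gcd(\emptyset)$ is regarded as $0$). *)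

(* Defs.v *)
From mathcomp Require Import all_boot all_order all_algebra.
From mathcomp Require Import classical_sets reals.

Set Implicit Arguments.
Unset Strict Implicit.
Unset Printing Implicit Defensive.

Import Order.TTheory GRing.Theory Num.Theory.
Local Open Scope classical_set_scope.
Local Open Scope ring_scope.

(* Index values range over 'I_n = {0, .., n-1} instead of {1, .., n}. *)
Definition tensor (R : realType) (m n : nat) := m.-tuple 'I_n -> R.

(* Tensor orders m >= 2 are written m.+2 from here on, so that an index
   sequence has the form i1 :: i2 :: t with t : m.-tuple 'I_n. *)
Section Tensors.
Context {R : realType} {m n : nat}.
Implicit Types A B : tensor R m.+2 n.

(* If i = (i1, i2, .., ik), then belast i2 (i3, .., ik) = (i2, .., i(k-1)). *)
Definition boxprod A B : tensor R m.+2 n := fun i =>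
  \sum_(j < n)
     A [tuple of thead i :: j :: belast (tnth i 1) (behead (behead i))]
   * B [tuple of j :: behead i].

(* tpow A 0 = A is a junk value: exponents are positive in all uses below. *)
Definition tpow A (a : nat) : tensor R m.+2 n :=
  iter a.-1 (fun B => boxprod B A) A.

Definition nonneg_tensor A : Prop := forall i, 0 <= A i.

Definition pos_tensor A : Prop := forall i, 0 < A i.

Definition s_irreducible A : Prop :=
  forall i, exists a : nat, (1 <= a)%N /\ 0 < tpow A a i.

Definition s_primitive A : Prop :=
  exists a : nat, (1 <= a)%N /\ pos_tensor (tpow A a).

(* i -> j: the target j is the first index of the entry, the source i the
   second one. *)
Definition accessible A (i j : 'I_n) : Prop :=
  forall t : m.-tuple 'I_n,
    exists a : nat, (1 <= a)%N /\ 0 < tpow A a [tuple of j :: i :: t].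

Definition S_set A (i j : 'I_n) : set nat :=
  [set a | (1 <= a)%N /\
           forall t : m.-tuple 'I_n, 0 < tpow A a [tuple of j :: i :: t]].

(* "Greatest" is for divisibility, so that 0 is the gcd of the empty set. *)
Definition is_gcd (X : set nat) (d : nat) : Prop :=
  (forall x, X x -> d %| x)%N /\
  (forall e, (forall x, X x -> e %| x) -> e %| d)%N.

Definition aperiodic A (i : 'I_n) : Prop := is_gcd (S_set A i i) 1%N.

End Tensors.

(* Main.v *)
Require Import Defs.
From mathcomp Require Import all_boot all_order all_algebra.
From mathcomp Require Import boolp classical_sets reals.
From mathcomp Require Import zify.

Set Implicit Arguments.
Unset Strict Implicit.
Unset Printing Implicit Defensive.

Import Order.TTheory GRing.Theory Num.Theory.
Local Open Scope classical_set_scope.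
Local Open Scope ring_scope.

(** Read [A] as the weights of a walk with memory: from the state (i2, .., im)
the step to (j, i2, .., i(m-1)) has weight A(j, i2, .., im). The entry of A^a at
(i1, i2, .., im) is the total weight of the a-step walks from (i2, .., im) to a
state with head i1, so a lies in S(i, j) iff every state with head i has an
a-step walk of positive weight to some state with head j. Concatenating walks
shows that S(i, j) + S(j, k) is contained in S(i, k). Hence S(i, i) is an additive
semigroup; if its gcd is 1 it contains all large integers, and then so does every
nonempty S(j, i). Conversely, if A^a > 0 then every state has an outgoing step,
so A^(a+1) > 0 as well, and a, a+1 both lie in S(i, i). *)

Section AdditiveSemigroups.
Variable X : set nat.
Hypothesis XD : forall x y, X x -> X y -> X (x + y)%N.

Lemma semigroup_mul q x : (0 < q)%N -> X x -> X (q * x)%N.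
Proof.
move=> + Xx; elim: q => // -[|q] IHq _; first by rewrite mul1n.
by rewrite mulSn; apply: XD => //; exact: IHq.
Qed.

Lemma semigroup_mulD q x y : X x -> X y -> X (q * x + y)%N.
Proof.
by case: q => [|q] Xx Xy; [rewrite mul0n | apply: XD => //; exact: semigroup_mul].
Qed.

(* The least positive gap d between two elements of X divides every z in X:
otherwise z %% d would be a smaller gap. *)
Lemma semigroup_consecutive : (forall x, X x -> (0 < x)%N) -> is_gcd X 1 ->
  exists2 x, X x & X x.+1.
Proof.
move=> X_gt0 [_ gcdX].
have [x0 Xx0] : exists x, X x.
  (* If [X] were empty, 0 would vacuously divide all its elements, hence 1. *)
  apply: contrapT => X0; suff: (0 %| 1)%N by [].
  by apply: gcdX => x Xx; case: X0; exists x.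
pose D d := `[< (0 < d)%N /\ exists2 x, X x & X (x + d)%N >].
have exD : exists d, D d.
  exists x0; apply/asboolP; split; first exact: X_gt0.
  by exists x0 => //; exact: XD.
case: (ex_minnP exD) => d /asboolP[d_gt0 [x Xx Xxd]] d_min.
suff d1 : d = 1%N by exists x => //; rewrite -addn1 -d1.
apply/eqP; rewrite -dvdn1; apply: gcdX => z Xz; apply: contrapT => /negP.
rewrite /dvdn -lt0n => r_gt0.
have := ltn_pmod z d_gt0; rewrite ltnNge => /negP; apply; apply: d_min.
(* With q = [z %/ d], the elements q(x + d) + x and qx + (z + x) of [X] differ by z - qd =
   [z %% d]. *)
apply/asboolP; split=> //; exists (z %/ d * (x + d) + x)%N.
  exact: semigroup_mulD.
rewrite (_ : _ + _ = z %/ d * x + (z + x))%N; last first.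
  rewrite mulnDr -!addnA; congr addn.
  by rewrite [in RHS](divn_eq z d) -addnA [(x + _)%N]addnC.
by apply: semigroup_mulD => //; exact: XD.
Qed.

(** Take x, x + 1 in [X] and k = qx + r with r < x. Then k = r(x + 1) + (q - r)x, and k >= x * x
    forces q >= x > r, so the second coefficient is positive. *)
Lemma semigroup_cofinite : (forall x, X x -> (0 < x)%N) -> is_gcd X 1 ->
  exists N, forall k, (N <= k)%N -> X k.
Proof.
move=> X_gt0 gcdX; have [x Xx Xx1] := semigroup_consecutive X_gt0 gcdX.
have x_gt0 := X_gt0 _ Xx.
exists (x * x)%N => k le_k.
have le_q : (x <= k %/ x)%N by rewrite leq_divRL.
have lt_r := ltn_pmod k x_gt0.
have -> : k = ((k %% x) * x.+1 + (k %/ x - k %% x) * x)%N.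
  rewrite mulnBl mulnS -addnA subnKC ?leq_mul2r; last by lia.
  by rewrite addnC -divn_eq.
by apply: semigroup_mulD => //; apply: semigroup_mul => //; lia.
Qed.

End AdditiveSemigroups.

Section Walks.
Context {R : realType} {m n : nat}.
Implicit Types (A B : tensor R m.+2 n) (s : m.+1.-tuple 'I_n).

Definition shift (j : 'I_n) s : m.+1.-tuple 'I_n :=
  [tuple of j :: belast (thead s) (behead s)].

Lemma boxprodE A B k s :
  boxprod A B [tuple of k :: s] =
  \sum_(j < n) A [tuple of k :: shift j s] * B [tuple of j :: s].
Proof.
apply: eq_bigr => j _; congr (A _ * B _); apply: val_inj => //=.
by congr [:: _, _ & belast _ _]; rewrite (tnth_nth k) /thead (tnth_nth k).
Qed.

Lemma tpowS A a : (0 < a)%N -> tpow A a.+1 = boxprod (tpow A a) A.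
Proof. by case: a. Qed.

Section Nonneg.
Variable A : tensor R m.+2 n.
Hypothesis A_ge0 : nonneg_tensor A.

Lemma tpow_ge0 a : nonneg_tensor (tpow A a).
Proof.
rewrite /tpow; elim: a.-1 => //= b IHb i.
by apply: sumr_ge0 => j _; apply: mulr_ge0.
Qed.

(** Nonnegative terms cannot cancel. The last factor [A] of the power is the first step of the walk,
    out of [s]. *)
Lemma tpowS_gt0 a k s : (0 < a)%N ->
  0 < tpow A a.+1 [tuple of k :: s] <->
  exists2 j, 0 < tpow A a [tuple of k :: shift j s] & 0 < A [tuple of j :: s].
Proof.
move=> a_gt0; rewrite tpowS // boxprodE.
have F_ge0 j : 0 <= tpow A a [tuple of k :: shift j s] * A [tuple of j :: s].
  by rewrite mulr_ge0 // tpow_ge0.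
split=> [|[j aj Aj]]; last first.
  by rewrite (bigD1 j) //= ltr_pwDl ?mulr_gt0 ?sumr_ge0.
rewrite lt0r => /andP[/eqP sum_neq0 _]; apply: contrapT => no_j.
apply: sum_neq0; apply: big1 => j _; apply/eqP; apply: contrapT => /negP.
rewrite mulf_eq0 negb_or => /andP[aj Aj].
by case: no_j; exists j; rewrite lt0r ?aj ?Aj ?tpow_ge0 ?A_ge0.
Qed.

(** Induction on [a] peels off first steps, as the box product is not associative. The [a] steps end
    at head [j] with an uncontrolled tail, which is why [S_set] must quantify over all tails. *)
Lemma tpowD_gt0 a b k j s : (0 < a)%N -> S_set A j k b ->
  0 < tpow A a [tuple of j :: s] -> 0 < tpow A (a + b) [tuple of k :: s].
Proof.
move=> + [b_gt0 Sb]; elim: a s => // -[|a] IHa s _.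
  move=> Aj; rewrite add1n; apply/tpowS_gt0 => //; exists j => //.
  exact: (Sb [tuple of belast (thead s) (behead s)]).
case/tpowS_gt0 => // l aj Al; rewrite addSn; apply/tpowS_gt0 => //.
by exists l => //; exact: IHa.
Qed.

Lemma S_setD i j k a b :
  S_set A i j a -> S_set A j k b -> S_set A i k (a + b)%N.
Proof.
move=> [a_gt0 Sa] Sb; split=> [|t]; first exact: ltn_addr.
exact: (tpowD_gt0 (s := [tuple of i :: t]) a_gt0 Sb (Sa t)).
Qed.

Lemma tpow_pos_out a s : (0 < a)%N -> pos_tensor (tpow A a) -> (0 < n)%N ->
  exists j, 0 < A [tuple of j :: s].
Proof.
move=> a_gt0 apos n_gt0; pose k := Ordinal n_gt0.
case: a a_gt0 apos => // -[|a] _ apos; first by exists k; exact: apos.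
have [|j _ Aj] := (tpowS_gt0 k s (ltn0Sn a)).1; first exact: apos.
by exists j.
Qed.

Lemma tpow_posS a : (0 < n)%N -> (0 < a)%N -> pos_tensor (tpow A a) ->
  pos_tensor (tpow A a.+1).
Proof.
move=> n_gt0 a_gt0 apos i; rewrite (tuple_eta i); apply/tpowS_gt0 => //.
have [j Aj] := tpow_pos_out [tuple of behead i] a_gt0 apos n_gt0.
by exists j => //; exact: apos.
Qed.

Lemma S_set_pos a i j : (0 < a)%N -> pos_tensor (tpow A a) -> S_set A i j a.
Proof. by move=> a_gt0 apos; split=> // t; exact: apos. Qed.

Lemma aperiodic_cofinite i j : aperiodic A i -> S_set A j i !=set0 ->
  exists N, forall k, (N <= k)%N -> S_set A j i k.
Proof.
move=> api [a Sa].
have [|x []|N SN] := semigroup_cofinite _ _ api => //.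
  by move=> x y; exact: S_setD.
exists (a + N)%N => k le_k; rewrite (_ : k = a + (k - a))%N; last by lia.
by apply: S_setD Sa _; apply: SN; lia.
Qed.

End Nonneg.
End Walks.

Theorem theorem2p7 (R : realType) (m n : nat) (hn : (2 <= n)%N)
    (A : tensor R m.+2 n) (hA : nonneg_tensor A) :
  s_primitive A <->
  [/\ s_irreducible A,
      (forall i j : 'I_n, accessible A i j -> S_set A i j !=set0)
    & (forall i : 'I_n, aperiodic A i)].
Proof.
split=> [[a [a_gt0 apos]]|[irrA accS aperA]].
  split=> [i|i j _|i]; first by exists a.
    by exists a; exact: S_set_pos.
  split=> [x _|e div_e]; first exact: dvd1n.
  have ea : (e %| a)%N by apply: div_e; exact: S_set_pos.
  rewrite -(dvdn_addr 1 ea) addn1; apply: div_e; apply: S_set_pos => //.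
  by apply: tpow_posS => //; exact: ltnW.
(* By s-irreducibility every pair is accessible, so (ii) applies to all pairs. *)
have cofin (p : 'I_n * 'I_n) :
    exists N, forall k, (N <= k)%N -> S_set A p.1 p.2 k.
  by apply: aperiodic_cofinite => //; apply: accS => t; exact: irrA.
have [N SN] := choice cofin.
(* The maximum over the finitely many pairs serves all entries at once; the successor keeps the
   exponent positive. *)
exists (\max_p N p).+1; split=> // i.
(* The source is the second index of the entry, the target the first. *)
have := SN (thead [tuple of behead i], thead i) (\max_p N p).+1.
case=> [|_ /(_ [tuple of behead (behead i)])]; first exact/leqW/leq_bigmax.
congr (0 < tpow _ _ _); apply: val_inj.
rewrite [in RHS](tuple_eta i) /=; congr cons.
exact/esym/(congr1 val (tuple_eta [tuple of behead i])).
Qed.
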